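(* Let $\mathbb{H}$ be a real or complex Hilbert space, let $A\in\mathbb{B}(\mathbb{H})$ be a nonzero positive operator, and let $T\in\mathbb{B}_{A^{1/2}}(\mathbb{H})$ be such that $\|T\|_A\neq 0$. Then the semi-norm $\|\cdot\|_A$ on $\mathbb{B}_{A^{1/2}}(\mathbb{H})$ is Gâteaux differentiable at $T$ if and only if $T$ is $A$-smooth.
   Context: $\mathbb{B}(\mathbb{H})$ is the set of bounded linear operators on the Hilbert space $(\mathbb{H},\langle\cdot,\cdot\rangle)$. A positive operator $A$ is a self-adjoint operator with $\langle Ax,x\rangle\ge 0$ for all $x$. It induces the semi-inner product $\langle x,y\rangle_A=\langle Ax,y\rangle$ and the semi-norm $\|x\|_A=\sqrt{\langle x,x\rangle_A}=\|A^{1/2}x\|$. $\mathbb{B}_{A^{1/2}}(\mathbb{H})$ is the set of $A$-bounded operators, i.e. those $T\in\mathbb{B}(\mathbb{H})$ for which there is $c>0$ with $\|Tx\|_A\le c\|x\|_A$ for all $x\in\mathbb{H}$; for such $T$, $\|T\|_A=\sup\{\|Tx\|_A:\|x\|_A=1\}$. For $T,S\in\mathbb{B}_{A^{1/2}}(\mathbb{H})$ the right-hand and left-hand Gâteaux derivatives of $\|\cdot\|_A$ at $T$ in the direction $S$ are $\rho_{\pm}^A(T,S)=\lim_{t\to 0^{\pm}}\frac{\|T+tS\|_A-\|T\|_A}{t}$ ($t$ real), and $\|\cdot\|_A$ is Gâteaux differentiable at $T$ if $\rho_+^A(T,S)=\rho_-^A(T,S)$ for all $S\in\mathbb{B}_{A^{1/2}}(\mathbb{H})$.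 $T\perp_A^B S$ means $\|T+\lambda S\|_A\ge\|T\|_A$ for all scalars $\lambda$. An operator $T\in\mathbb{B}_{A^{1/2}}(\mathbb{H})$ with $\|T\|_A\neq 0$ is called $A$-smooth if for all $S_1,S_2\in\mathbb{B}_{A^{1/2}}(\mathbb{H})$, $T\perp_A^B S_1$ and $T\perp_A^B S_2$ imply $T\perp_A^B S_1+S_2$. *)

(* Defs.v *)
From HB Require Import structures.
From mathcomp Require Import all_boot all_order all_algebra.
From mathcomp Require Import complex.
From mathcomp Require Import all_classical all_reals all_analysis.

Set Implicit Arguments.
Unset Strict Implicit.
Unset Printing Implicit Defensive.

Import Order.TTheory GRing.Theory Num.Theory.
Import numFieldNormedType.Exports.

Local Open Scope classical_set_scope.
Local Open Scope ring_scope.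

Variant scalar_kind := RealScalars | ComplexScalars.

Section Scalars.
Variable R : realType.

Definition scalar_field (k : scalar_kind) : numFieldType :=
  match k with RealScalars => R | ComplexScalars => R[i] end.

Definition scalar_conj (k : scalar_kind) : scalar_field k -> scalar_field k :=
  match k with
  | RealScalars => fun z => z
  | ComplexScalars => fun z => conjc z
  end.

Definition scalar_of_real (k : scalar_kind) : R -> scalar_field k :=
  match k with
  | RealScalars => fun r => r
  | ComplexScalars => fun r => r%:C%C
  end.

Definition scalar_re (k : scalar_kind) : scalar_field k -> R :=
  match k with
  | RealScalars => fun z => z
  | ComplexScalars => fun z => complex.Re z
  end.

End Scalars.

Arguments scalar_conj {R} k.
Arguments scalar_of_real {R} k.
Arguments scalar_re {R} k.

(* The inner product is linear in its first argument and conjugate-linear in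
   its second one; the norm of the carrier, whose values lie in the scalar
   field, is the one it induces. *)
Record hilbertSpace (R : realType) (k : scalar_kind) := HilbertSpace {
  hilbert_carrier :> completeNormedModType (scalar_field R k);
  inner : {dot hilbert_carrier for scalar_conj k};
  sqr_norm_inner : forall x : hilbert_carrier, `|x| ^+ 2 = inner x x
}.

Section SemiHilbert.
Variables (R : realType) (k : scalar_kind) (H : hilbertSpace R k).
Implicit Types (A S T : {linear H -> H}) (x y : H).

Definition bounded_operator T : Prop :=
  exists M : scalar_field R k, forall x, `|T x| <= M * `|x|.

(* In the complex case [0 <= z] says that [z] is real and nonnegative. *)
Definition positive_operator A : Prop :=
  [/\ bounded_operator A,
      forall x y, inner H (A x) y = inner H x (A y) &
      forall x, 0 <= inner H (A x) x].

Definition inner_A A x y : scalar_field R k := inner H (A x) y.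

Definition seminorm_A A x : R := Num.sqrt (scalar_re k (inner_A A x x)).

Definition A_bounded A T : Prop :=
  bounded_operator T /\
  exists2 c : R, 0 < c & forall x, seminorm_A A (T x) <= c * seminorm_A A x.

(* The argument is a bare function so that [T \+ S] and [a \*: S] can be
   passed directly. *)
Definition opnorm_A A (T : H -> H) : R :=
  sup [set seminorm_A A (T x) | x in [set x | seminorm_A A x = 1]].

Definition gateaux_quotient A T S (t : R) : R :=
  (opnorm_A A (T \+ scalar_of_real k t \*: S) - opnorm_A A T) / t.

Definition rho_right A T S : R := lim (gateaux_quotient A T S t @[t --> 0^'+]).

Definition rho_left A T S : R := lim (gateaux_quotient A T S t @[t --> 0^'-]).

(* [lim] is a default value on divergent filters, hence the explicit
   convergence of both one-sided quotients. *)
Definition gateaux_differentiable A T : Prop :=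
  forall S, A_bounded A S ->
    [/\ cvg (gateaux_quotient A T S t @[t --> 0^'+]),
        cvg (gateaux_quotient A T S t @[t --> 0^'-]) &
        rho_right A T S = rho_left A T S].

Definition birkhoff_orthogonal A (T S : H -> H) : Prop :=
  forall a : scalar_field R k, opnorm_A A T <= opnorm_A A (T \+ a \*: S).

Definition A_smooth A T : Prop :=
  [/\ A_bounded A T, opnorm_A A T != 0 &
      forall S1 S2, A_bounded A S1 -> A_bounded A S2 ->
        birkhoff_orthogonal A T S1 -> birkhoff_orthogonal A T S2 ->
        birkhoff_orthogonal A T (S1 \+ S2)].

End SemiHilbert.

(* Main.v *)
From HB Require Import structures.
Require Import Defs.
From mathcomp Require Import all_boot all_order all_algebra.
From mathcomp Require Import complex.
From mathcomp Require Import all_classical all_reals all_analysis.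
From mathcomp Require Import lra.

Set Implicit Arguments.
Unset Strict Implicit.
Unset Printing Implicit Defensive.

Import Order.TTheory GRing.Theory Num.Theory.
Import numFieldNormedType.Exports.

Local Open Scope classical_set_scope.
Local Open Scope ring_scope.

(** The equivalence is a fact about an arbitrary seminorm [N] on a subspace [D]
    of a real or complex vector space, applied to the operator seminorm on the
    [A]-bounded operators.

    By convexity the difference quotient [q U t = (N (T + t U) - N T) / t] is
    nondecreasing in [t > 0] and bounded below by [- N U], so both one-sided
    derivatives exist: the right one is [p U = inf_(t > 0) q U t] and the left
    one is [- p (- U)] ([difference_quotient_cvg],
    [difference_quotient_cvg_left]). The functional [p] is sublinear over the
    reals, and Birkhoff orthogonality of [T] to [U] means exactly that
    [0 <= p (a U)] for every scalar [a]
    ([right_derivative_orthogonalP]). Differentiability at [T] says that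
    [p U = - p (- U)] for all [U].

    If [p] is odd, then it is additive, and orthogonality, which becomes
    [p (a U) = 0] for all [a], passes to sums.

    Conversely, extending [p U] from the real multiples of [U] to the scalar
    ones by Hahn-Banach ([sublinear_support]) yields a scalar [c] such that
    [re c * N T = p U] and [T] is orthogonal to [U - c T]
    ([exists_orthogonal_shift]). Doing the same for [- U] yields [d] with
    [re d * N T = p (- U)] and [T] orthogonal to [- U - d T]. Additivity makes
    [T] orthogonal to [- (c + d) T]; since [N T > 0] this forces [c + d = 0],
    and the real part of this equation is [p U + p (- U) = 0].

    For the operator seminorm, the Cauchy-Schwarz inequality for the real part
    of the form [<A x, y>] gives the triangle inequality of the seminorm on
    vectors, and taking suprema over the unit vectors transfers it to
    operators. *)

(** * Real parts and moduli of scalars *)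

Section RealScalars.
Variables (R : realType) (k : scalar_kind).
Local Notation K := (scalar_field R k).
Local Notation ofr := (@scalar_of_real R k).
Local Notation re := (@scalar_re R k).

Lemma scalar_of_real_is_zmod_morphism : zmod_morphism ofr.
Proof. by case: k => // x y /=; rewrite rmorphB. Qed.

Lemma scalar_of_real_is_monoid_morphism : monoid_morphism ofr.
Proof. by case: k => //; split=> [|x y] /=; rewrite ?rmorph1 ?rmorphM. Qed.

HB.instance Definition _ :=
  GRing.isZmodMorphism.Build R K ofr scalar_of_real_is_zmod_morphism.
HB.instance Definition _ :=
  GRing.isMonoidMorphism.Build R K ofr scalar_of_real_is_monoid_morphism.

Lemma scalar_re_is_zmod_morphism : zmod_morphism re.
Proof. by case: k => // -[a b] [c d]. Qed.

HB.instance Definition _ :=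
  GRing.isZmodMorphism.Build K R re scalar_re_is_zmod_morphism.

Lemma scalar_reZ r z : re (ofr r * z) = r * re z.
Proof. by case: k z => //= -[a b] /=; rewrite mul0r subr0. Qed.

Lemma scalar_reK r : re (ofr r) = r.
Proof. by case: k. Qed.

Lemma scalar_re_conj z : re (scalar_conj k z) = re z.
Proof. by case: k z => //= -[a b]. Qed.

Lemma scalar_re_ge0 z : 0 <= z -> 0 <= re z.
Proof. by case: k z => //= -[a b]; rewrite lecE /= => /andP[]. Qed.

(** The norm of a scalar takes its values in the scalar field itself; this is
    the same number seen in [R]. *)
Definition scalar_abs (z : K) : R := re `|z|.

Lemma scalar_absE z : ofr (scalar_abs z) = `|z|.
Proof. by rewrite /scalar_abs; case: k z => //= z. Qed.

Lemma scalar_abs_ge0 z : 0 <= scalar_abs z.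
Proof. exact/scalar_re_ge0/normr_ge0. Qed.

Lemma scalar_abs_real r : scalar_abs (ofr r) = `|r|.
Proof.
by rewrite /scalar_abs; case: k => //=; rewrite expr0n addr0 sqrtr_sqr.
Qed.

Lemma mulr_scalar_conj z : z * scalar_conj k z = ofr (scalar_abs z ^+ 2).
Proof.
rewrite rmorphXn /= scalar_absE; case: k z => /= z.
  by rewrite real_normK ?num_real // expr2.
by rewrite sqr_normc.
Qed.

(** This linear bound is all that differentiating a seminorm along scalar
    multiples of its base point requires: the imaginary part of the direction
    contributes only at second order. *)
Lemma scalar_abs_1D t z :
  scalar_abs (1 + ofr t * z) <= 1 + t * re z + t ^+ 2 * scalar_abs z ^+ 2 / 2.
Proof.
have absE2 : scalar_abs (1 + ofr t * z) ^+ 2 =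
    1 + 2 * (t * re z + t ^+ 2 * scalar_abs z ^+ 2 / 2).
  (* The squared modulus is expanded as [(1 + t z) * conj (1 + t z)]. *)
  have cD x y : scalar_conj k (x + y) = scalar_conj k x + scalar_conj k y.
    by case: (k) x y => //= x y; rewrite rmorphD.
  have cM x y : scalar_conj k (x * y) = scalar_conj k x * scalar_conj k y.
    by case: (k) x y => //= x y; rewrite rmorphM.
  have cR r : scalar_conj k (ofr r) = ofr r by case: (k) => //=; rewrite oppr0.
  rewrite -[LHS]scalar_reK -mulr_scalar_conj cD -(rmorph1 ofr) cR cM cR.
  rewrite mulrDl !mulrDr !raddfD /= -!mulrA !scalar_reZ (mulrCA z) !scalar_reZ.
  rewrite mulr_scalar_conj !scalar_reK scalar_re_conj.
  by rewrite (rmorph1 ofr) (mulr1 z); lra.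
set w := t * _ + _ in absE2; rewrite -addrA -/w.
have w_ge : 0 <= 1 + w.
  by have := sqr_ge0 (scalar_abs (1 + ofr t * z)); rewrite absE2; lra.
(* [1 + 2 w <= (1 + w) ^ 2]. *)
by rewrite -(ler_pXn2r (ltn0Sn 1)) ?nnegrE ?scalar_abs_ge0 // absE2; nra.
Qed.

Lemma exists_between (f g : R -> R) :
  (forall x y, f x <= g y) -> exists b, forall x, f x <= b <= g x.
Proof.
move=> fg; have fub : has_ubound (range f) by exists (g 0) => _ [x _ <-].
exists (sup (range f)) => x; apply/andP; split.
  by apply: ub_le_sup => //; exists x.
by apply: ge_sup; [exists (f 0), 0 | move=> _ [y _ <-]].
Qed.

(** The Hahn-Banach theorem on the scalar field: [a |-> re (a * c)] is a real
    functional below [p] touching it at [1]. Over the real numbers [c = p 1] is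
    forced; over the complex numbers the real axis is extended by one
    dimension, and [- Im c] is any number separating the slopes that [p]
    allows on either side of it. *)
Lemma sublinear_support (p : K -> R) :
  (forall a b, p (a + b) <= p a + p b) ->
  (forall r a, 0 < r -> p (ofr r * a) = r * p a) ->
  exists c, re c = p 1 /\ forall a, re (a * c) <= p a.
Proof.
move=> pD pZ.
have p0 : p 0 = 0 by have := pZ 2 0 ltac:(lra); rewrite mulr0; lra.
have pR x : x * p 1 <= p (ofr x).
  have [x0|x0|->] := ltgtP x 0; last by rewrite rmorph0 p0 mul0r.
    have := pD (ofr x) (ofr (- x) * 1).
    rewrite pZ ?oppr_gt0 // mulr1 -rmorphD subrr rmorph0 p0; lra.
  by rewrite -[ofr x]mulr1 pZ.
case: k p pD pZ p0 pR => /= p pD pZ p0 pR.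
  by exists (p 1); split=> // a; exact: pR.
have [|b hb] := @exists_between (fun x => x * p 1 - p (x -i* 1)%C)
    (fun x => p (x +i* 1)%C - x * p 1).
  move=> x y /=; have := pD (x -i* 1)%C (y +i* 1)%C.
  have -> : ((x -i* 1) + (y +i* 1))%C = (x + y)%:C%C :> R[i].
    by apply/eqP; rewrite eq_complex /= addNr !eqxx.
  by have := pR (x + y); lra.
exists (p 1 -i* b)%C; split=> // -[x y] /=.
have polar r u v : 0 < r -> p (r * u +i* (r * v))%C = r * p (u +i* v)%C.
  by move=> r0; rewrite -pZ //; congr p; apply/eqP;
     rewrite eq_complex /= !mul0r subr0 addr0 !eqxx.
have [y0|y0|->] := ltgtP y 0; last by rewrite mul0r subr0; exact: pR.
- have Ny0 : 0 < - y by rewrite oppr_gt0.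
  have xE : - y * (x / - y) = x by rewrite mulrC divfK // gt_eqF.
  have /andP[+ _] := hb (x / - y); rewrite -(ler_pM2l Ny0) mulrBr.
  rewrite -(polar _ (x / - y)) //.
  by rewrite mulrA xE mulrN1 opprK; lra.
have xE : y * (x / y) = x by rewrite mulrC divfK // gt_eqF.
have /andP[_] := hb (x / y); rewrite -(ler_pM2l y0) mulrBr.
rewrite -(polar _ (x / y)) //.
by rewrite (mulrA y _ (p 1)) xE mulr1; lra.
Qed.

End RealScalars.

(** * One-sided derivatives of a seminorm *)

Section OneSidedDerivative.
Variables (R : realType) (k : scalar_kind).
Local Notation K := (scalar_field R k).
Local Notation ofr := (@scalar_of_real R k).
Local Notation re := (@scalar_re R k).
Variables (V : lmodType K) (D : V -> Prop) (N : V -> R).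
Hypothesis addD : forall x y, D x -> D y -> D (x + y).
Hypothesis scaleD : forall a x, D x -> D (a *: x).
Hypothesis N_add : forall x y, D x -> D y -> N (x + y) <= N x + N y.
Hypothesis N_scale : forall a x, D x -> N (a *: x) = scalar_abs a * N x.
Variable T : V.
Hypothesis DT : D T.

Lemma oppD x : D x -> D (- x).
Proof. by rewrite -scaleN1r; exact: scaleD. Qed.

Lemma seminorm_scale_real r x : D x -> N (ofr r *: x) = `|r| * N x.
Proof. by move=> Dx; rewrite N_scale // scalar_abs_real. Qed.

Lemma seminorm_zero : N 0 = 0.
Proof.
by rewrite -(scale0r T) -(rmorph0 ofr) seminorm_scale_real // normr0 mul0r.
Qed.

Lemma seminorm_ge0 x : D x -> 0 <= N x.
Proof.
move=> Dx; have := N_add Dx (oppD Dx); rewrite subrr seminorm_zero.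
have -> : - x = ofr (- 1) *: x by rewrite rmorphN1 scaleN1r.
by rewrite seminorm_scale_real // normrN1; lra.
Qed.

Definition difference_quotient (U : V) (t : R) : R :=
  (N (T + ofr t *: U) - N T) / t.

Definition right_derivative (U : V) : R :=
  inf (difference_quotient U @` [set` `]0, +oo[]).

Local Notation q := difference_quotient.
Local Notation p := right_derivative.

(** Convexity of [N]: for [s <= t] the point [T + s U] lies on the segment from
    [T] to [T + t U]. *)
Lemma difference_quotient_nondecreasing U s t : D U ->
  0 < s -> s <= t -> q U s <= q U t.
Proof.
move=> DU s0 st; have t0 := lt_le_trans s0 st.
have r0 : 0 < s / t by rewrite divr_gt0.
have r1 : s / t <= 1 by rewrite ler_pdivrMr // mul1r.
have /N_add : D (ofr (1 - s / t) *: T) by exact: scaleD.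
move=> /(_ (ofr (s / t) *: (T + ofr t *: U))).
have DtU : D (T + ofr t *: U) by apply/addD/scaleD.
have -> : ofr (1 - s / t) *: T + ofr (s / t) *: (T + ofr t *: U) =
    T + ofr s *: U.
  rewrite scalerDr addrA -scalerDl -rmorphD subrK rmorph1 scale1r scalerA.
  by rewrite -rmorphM divfK ?gt_eqF.
rewrite !seminorm_scale_real // (gtr0_norm r0) ger0_norm ?subr_ge0 //.
move=> /(_ (scaleD _ DtU)).
rewrite /q => h; rewrite ler_pdivrMr // mulrAC -mulrA mulrC.
move: h; move: (s / t) (N _) => *; lra.
Qed.

(** The triangle inequality for [T = (T + t U) - t U]. *)
Lemma difference_quotient_ge U t : D U -> 0 < t -> - N U <= q U t.
Proof.
move=> DU t0; rewrite ler_pdivlMr //.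
have := N_add (addD DT (scaleD (ofr t) DU)) (scaleD (ofr (- t)) DU).
rewrite rmorphN scaleNr addrK -scaleNr -rmorphN seminorm_scale_real // normrN.
by rewrite gtr0_norm //; lra.
Qed.

Let has_lbound_quotient U : D U -> has_lbound (q U @` [set` `]0, +oo[]).
Proof.
move=> DU; exists (- N U) => _ [t /= + <-]; rewrite in_itv /= andbT.
exact: difference_quotient_ge.
Qed.

Lemma difference_quotient_cvg U : D U ->
  q U t @[t --> 0^'+] --> p U.
Proof.
move=> DU; apply: nondecreasing_at_right_cvgr => //; last first.
  exact: has_lbound_quotient.
move=> s t; rewrite !in_itv /= !andbT => s0 _.
exact: difference_quotient_nondecreasing.
Qed.

Lemma right_derivative_le U t : D U -> 0 < t -> p U <= q U t.
Proof.
move=> DU t0; apply: ge_inf; first exact: has_lbound_quotient.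
by exists t => //=; rewrite in_itv /= t0.
Qed.

Lemma le_right_derivative U m :
  (forall t, 0 < t -> m <= q U t) -> m <= p U.
Proof.
move=> mq; apply: lb_le_inf.
  by exists (q U 1), 1 => //=; rewrite in_itv /= ltr01.
by move=> _ [t /= + <-]; rewrite in_itv /= andbT; exact: mq.
Qed.

Lemma right_derivativeZ r U : D U -> 0 < r -> p (ofr r *: U) = r * p U.
Proof.
move=> DU r0.
have qZ s t : 0 < s -> q (ofr s *: U) t = s * q U (t * s).
  move=> s0; rewrite /q scalerA -rmorphM invfM [RHS]mulrCA (mulrC t^-1).
  by rewrite mulVKf ?gt_eqF.
apply/eqP; rewrite eq_le; apply/andP; split.
  rewrite -ler_pdivrMl //; apply: le_right_derivative => t t0.
  rewrite ler_pdivrMl //.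
  have := right_derivative_le (scaleD (ofr r) DU) (divr_gt0 t0 r0).
  by rewrite qZ // divfK ?gt_eqF.
apply: le_right_derivative => t t0; rewrite qZ // ler_pM2l //.
by apply: right_derivative_le => //; exact: mulr_gt0.
Qed.

(** [T + t (U + W)] is the midpoint of [T + 2 t U] and [T + 2 t W]. *)
Lemma right_derivativeD U W : D U -> D W -> p (U + W) <= p U + p W.
Proof.
move=> DU DW; rewrite -lerBlDr; apply: le_right_derivative => s s0.
rewrite lerBlDr -lerBlDl; apply: le_right_derivative => t t0.
rewrite lerBlDl; pose r := Num.min s t.
have r0 : 0 < r by rewrite lt_min s0.
have rs : r <= s by rewrite ge_min lexx.
have rt : r <= t by rewrite ge_min lexx orbT.
apply: (@le_trans _ _ (q U r + q W r)); last first.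
  by apply: lerD; exact: difference_quotient_nondecreasing.
have r20 : 0 < r / 2 by rewrite divr_gt0.
apply: (le_trans (right_derivative_le (addD DU DW) r20)).
have DrU : D (T + ofr r *: U) by apply/addD/scaleD.
have DrW : D (T + ofr r *: W) by apply/addD/scaleD.
have half : 2^-1 + 2^-1 = 1 :> R by lra.
have := N_add (scaleD (ofr 2^-1) DrU) (scaleD (ofr 2^-1) DrW).
rewrite !seminorm_scale_real // gtr0_norm ?invr_gt0 //.
have -> : ofr 2^-1 *: (T + ofr r *: U) + ofr 2^-1 *: (T + ofr r *: W) =
    T + ofr (r / 2) *: (U + W).
  rewrite !scalerDr addrACA -scalerDl -rmorphD half rmorph1 scale1r.
  by rewrite !scalerA -!rmorphM mulrC.
rewrite /q => h; rewrite -mulrDl ler_pdivrMr //.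
by rewrite mulrA divfK ?gt_eqF //; lra.
Qed.

(** The quotient is estimated by [scalar_abs_1D], whose quadratic term
    disappears as [t] tends to [0]. *)
Lemma right_derivative_base z : p (z *: T) <= re z * N T.
Proof.
apply/ler_addgt0Pr => e e0.
pose M := scalar_abs z ^+ 2 * N T / 2.
have M0 : 0 <= M by rewrite divr_ge0 // mulr_ge0 ?sqr_ge0 ?seminorm_ge0.
pose t := e / (M + 1).
have t0 : 0 < t by rewrite divr_gt0 //; lra.
apply: (le_trans (right_derivative_le (scaleD z DT) t0)).
rewrite /q -{1}(scale1r T) scalerA -scalerDl N_scale // ler_pdivrMr //.
have tM : t * M <= e.
  by rewrite /t mulrAC ler_pdivrMr; [nra | lra].
have := ler_wpM2r (seminorm_ge0 DT) (scalar_abs_1D t z).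
move: tM; rewrite /M; move: (N T) (scalar_abs _) (re z) => *; nra.
Qed.

(** From right to left, [q (a *: U) 1] bounds the infimum [p (a *: U)] from
    above; from left to right, every [q (a *: U) t] is nonnegative by
    orthogonality applied to the scalar [t * a]. *)
Lemma right_derivative_orthogonalP U : D U ->
  (forall a, N T <= N (T + a *: U)) <-> (forall a, 0 <= p (a *: U)).
Proof.
move=> DU; split=> [TU a|TU a].
  apply: le_right_derivative => t /ltW t0; apply: divr_ge0 => //.
  by rewrite subr_ge0 scalerA.
have := le_trans (TU a) (right_derivative_le (scaleD a DU) ltr01).
by rewrite /q rmorph1 scale1r divr1 subr_ge0.
Qed.

(** [c] is [f U / N T] for a support functional [f] of [N] at [T] whose real
    part attains [p U] at [U]. Only the restriction of [f] to the scalar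
    multiples of [U] and [T] matters, and [sublinear_support] provides it. *)
Lemma exists_orthogonal_shift U : D U -> 0 < N T ->
  exists c, re c * N T = p U /\
    forall a, N T <= N (T + a *: (U - c *: T)).
Proof.
move=> DU NT0.
have [||c [c1 cp]] := @sublinear_support R k (fun a => p (a *: U) / N T).
- move=> a b; rewrite -mulrDl ler_pM2r ?invr_gt0 // scalerDl.
  by apply: right_derivativeD; exact: scaleD.
- move=> r a r0; rewrite -scalerA right_derivativeZ ?mulrA //.
  exact: scaleD.
exists c; split; first by rewrite c1 scale1r divfK ?gt_eqF.
have DUc : D (U - c *: T) by apply/addD/oppD/scaleD.
apply/right_derivative_orthogonalP => // a.
have := right_derivativeD (scaleD a DUc) (scaleD (a * c) DT).
rewrite scalerBr scalerA subrK.
have := right_derivative_base (a * c); have := cp a.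
rewrite ler_pdivlMr //; lra.
Qed.

(** Oddness of the right derivative encodes Gateaux differentiability, because
    the left derivative along [U] is [- p (- U)]. *)
Theorem right_derivative_odd_iff_orthogonal_add : 0 < N T ->
  (forall U, D U -> p U = - p (- U)) <->
  (forall U W, D U -> D W -> (forall a, N T <= N (T + a *: U)) ->
    (forall a, N T <= N (T + a *: W)) ->
    forall a, N T <= N (T + a *: (U + W))).
Proof.
move=> NT0; split=> [podd U W DU DW|orthD U DU].
  move=> /(right_derivative_orthogonalP DU) TU.
  move=> /(right_derivative_orthogonalP DW) TW.
  apply/right_derivative_orthogonalP => [|a]; first exact: addD.
  have DaU := scaleD a DU; have DaW := scaleD a DW.
  (* [p (a U) <= p (a (U + W)) + p (- a W)], where [p (- a W) = - p (a W)] is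
     both nonnegative and nonpositive. *)
  have := right_derivativeD (scaleD a (addD DU DW)) (oppD DaW).
  rewrite {1}scalerDr addrK; have := TU a; have := TW a.
  rewrite (podd _ DaW); have := TW (- a); rewrite scaleNr; lra.
have [c [cU orthc]] := exists_orthogonal_shift DU NT0.
have [d [dU orthd]] := exists_orthogonal_shift (oppD DU) NT0.
have Dc z W : D W -> D (W - z *: T) by move=> DW; apply/addD/oppD/scaleD.
suff cd0 : c + d = 0.
  apply/eqP; rewrite -subr_eq0 opprK -cU -dU -mulrDl -raddfD cd0 raddf0.
  by rewrite mul0r.
have := orthD _ _ (Dc c _ DU) (Dc d _ (oppD DU)) orthc orthd.
have -> : U - c *: T + (- U - d *: T) = - (c + d) *: T.
  by rewrite addrACA subrr add0r -opprD -scalerDl scaleNr.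
move=> TcdT; apply/eqP/negP => /negP cd_neq0.
(* The multiple [(c + d)^-1] brings [T] to [0], of seminorm [0 < N T]. *)
have := TcdT (c + d)^-1.
by rewrite scalerA mulrN mulVf // scaleN1r subrr seminorm_zero leNgt NT0.
Qed.

Lemma difference_quotient_cvg_left U : D U ->
  q U t @[t --> 0^'-] --> - p (- U).
Proof.
move=> DU; apply/cvg_at_leftNP; rewrite oppr0.
have -> : q U \o -%R = (fun t => - q (- U) t).
  apply/funext => t; rewrite /q /= rmorphN scaleNr scalerN invrN mulrN.
  by [].
by apply: cvgN; apply: difference_quotient_cvg; exact: oppD.
Qed.

Lemma differentiable_iff_right_derivative_odd U : D U ->
  [/\ cvg (q U t @[t --> 0^'+]), cvg (q U t @[t --> 0^'-]) &
      lim (q U t @[t --> 0^'+]) = lim (q U t @[t --> 0^'-])] <->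
  p U = - p (- U).
Proof.
move=> DU; have rcvg := difference_quotient_cvg DU.
have lcvg := difference_quotient_cvg_left DU.
split=> [[_ _]|pU]; first by rewrite (cvg_lim _ rcvg) // (cvg_lim _ lcvg).
split; [by apply/cvg_ex; eexists; exact: rcvg| |].
  by apply/cvg_ex; eexists; exact: lcvg.
by rewrite (cvg_lim _ rcvg) // (cvg_lim _ lcvg).
Qed.

End OneSidedDerivative.

(** * The seminorm induced by a positive operator *)

Section SemiHilbertSpace.
Variables (R : realType) (k : scalar_kind) (H : hilbertSpace R k).
Local Notation K := (scalar_field R k).
Local Notation ofr := (@scalar_of_real R k).
Local Notation re := (@scalar_re R k).
Variable A : {linear H -> H}.
Hypothesis A_pos : positive_operator A.

(* Triangle and Cauchy-Schwarz inequalities involve only this symmetric real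
   bilinear form, which makes them uniform in the scalar field. *)
Let rform x y : R := re (inner_A A x y).

Lemma innerC x y : inner H x y = scalar_conj k (inner H y x).
Proof. by rewrite hermitian_subproof expr0 mul1r. Qed.

Let rformC x y : rform x y = rform y x.
Proof.
have [_ selfadj _] := A_pos.
by rewrite /rform /inner_A innerC scalar_re_conj selfadj.
Qed.

Let rformDl x y z : rform (x + y) z = rform x z + rform y z.
Proof. by rewrite /rform /inner_A linearD linearDl raddfD. Qed.

Let rformZl r x z : rform (ofr r *: x) z = r * rform x z.
Proof. by rewrite /rform /inner_A linearZ /= linearZl_LR /= scalar_reZ. Qed.

Let rform_ge0 x : 0 <= rform x x.
Proof. by have [_ _ Apos] := A_pos; exact/scalar_re_ge0/Apos. Qed.

Let sqr_seminorm x : seminorm_A A x ^+ 2 = rform x x.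
Proof. exact: sqr_sqrtr (rform_ge0 x). Qed.

Lemma seminorm_A_ge0 x : 0 <= seminorm_A A x.
Proof. exact: sqrtr_ge0. Qed.

(** The quadratic polynomial [rform (t x + y) (t x + y)] in [t] has no sign
    change, so its discriminant is nonpositive. *)
Let rform_le x y : rform x y <= seminorm_A A x * seminorm_A A y.
Proof.
apply: (le_trans (ler_norm _)).
rewrite -ler_sqr ?nnegrE ?mulr_ge0 ?sqrtr_ge0 //.
rewrite real_normK ?num_real // exprMn !sqr_seminorm -subr_le0.
pose r := Poly [:: rform y y; 2 * rform x y; rform x x].
have : r`_1 ^+ 2 - 4 * r`_2 * r`_0 <= 0.
  apply: deg_le2_poly_ge0; rewrite ?size_Poly // => t.
  have := rform_ge0 (ofr t *: x + y).
  rewrite horner_Poly /= rformDl rformZl (rformC x) (rformC y) !rformDl.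
  by rewrite !rformZl (rformC y x); lra.
by rewrite !coef_Poly /=; lra.
Qed.

Lemma seminorm_A_add x y :
  seminorm_A A (x + y) <= seminorm_A A x + seminorm_A A y.
Proof.
rewrite -(ler_pXn2r (ltn0Sn 1)) ?nnegrE ?addr_ge0 ?seminorm_A_ge0 //.
rewrite sqr_seminorm rformDl (rformC x) (rformC y) !rformDl sqrrD.
rewrite !sqr_seminorm (rformC y x); have := rform_le x y; lra.
Qed.

Lemma seminorm_A_scale a x :
  seminorm_A A (a *: x) = scalar_abs a * seminorm_A A x.
Proof.
rewrite /seminorm_A /inner_A [A _]linearZ /= linearZl_LR linearZr_LR /= mulrA.
rewrite mulr_scalar_conj scalar_reZ sqrtrM ?sqr_ge0 // sqrtr_sqr ger0_norm //.
exact: scalar_abs_ge0.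
Qed.

(** Stated on bare functions so that sums and multiples are those of the vector
    space [H -> H], on which the operator seminorm is defined. *)
Definition is_A_bounded_operator (f : H -> H) : Prop :=
  exists2 S : {linear H -> H}, A_bounded A S & f = S.

Lemma is_A_bounded_operator_add f g : is_A_bounded_operator f ->
  is_A_bounded_operator g -> is_A_bounded_operator (f + g).
Proof.
move=> [S [[M SM] [c c0 Sc]] ->] [U [[L UL] [d d0 Ud]] ->].
exists (S \+ U) => //; split.
  exists (M + L) => x; apply: (le_trans (ler_normD _ _)).
  by rewrite mulrDl lerD.
exists (c + d) => [|x]; first exact: addr_gt0.
by rewrite mulrDl; apply: (le_trans (seminorm_A_add _ _)); exact: lerD.
Qed.

Lemma is_A_bounded_operator_scale a f : is_A_bounded_operator f ->
  is_A_bounded_operator (a *: f).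
Proof.
move=> [S [[M SM] [c c0 Sc]] ->].
exists (a \*: S) => //; split.
  by exists (`|a| * M) => x; rewrite normrZ -mulrA ler_wpM2l.
exists (scalar_abs a * c + 1) => [|x].
  by rewrite ltr_wpDl // mulr_ge0 ?scalar_abs_ge0 // ltW.
rewrite seminorm_A_scale mulrDl mul1r -mulrA ler_wpDr ?seminorm_A_ge0 //.
by rewrite ler_wpM2l ?scalar_abs_ge0.
Qed.

Lemma opnorm_A_upper_bound f x : is_A_bounded_operator f ->
  seminorm_A A x = 1 -> seminorm_A A (f x) <= opnorm_A A f.
Proof.
move=> [S [_ [c c0 Sc]] ->] x1; apply: ub_le_sup; last by exists x.
by exists c => _ [y /= y1 <-]; have := Sc y; rewrite y1 mulr1.
Qed.

(* This keeps [opnorm_A A f] from being the supremum of the empty set, whose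
   value is the default one. *)
Hypothesis unit_vectors : [set x : H | seminorm_A A x = 1] !=set0.

Lemma opnorm_A_le f m :
  (forall x, seminorm_A A x = 1 -> seminorm_A A (f x) <= m) ->
  opnorm_A A f <= m.
Proof.
move=> fm; apply: ge_sup; last by move=> _ [x /= x1 <-]; exact: fm.
by have [x x1] := unit_vectors; exists (seminorm_A A (f x)), x.
Qed.

Lemma opnorm_A_ge0 f : is_A_bounded_operator f -> 0 <= opnorm_A A f.
Proof.
move=> bf; have [x x1] := unit_vectors.
exact: le_trans (seminorm_A_ge0 _) (opnorm_A_upper_bound bf x1).
Qed.

Lemma opnorm_A_add f g : is_A_bounded_operator f -> is_A_bounded_operator g ->
  opnorm_A A (f + g) <= opnorm_A A f + opnorm_A A g.
Proof.
move=> bf bg; apply: opnorm_A_le => x x1.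
apply: (le_trans (seminorm_A_add _ _)).
by apply: lerD; exact: opnorm_A_upper_bound.
Qed.

(** One inequality is immediate from the definition; applied to [a^-1] and
    [a *: f], it gives the other. *)
Lemma opnorm_A_scale a f : is_A_bounded_operator f ->
  opnorm_A A (a *: f) = scalar_abs a * opnorm_A A f.
Proof.
have le b g : is_A_bounded_operator g ->
    opnorm_A A (b *: g) <= scalar_abs b * opnorm_A A g.
  move=> bg; apply: opnorm_A_le => x x1; rewrite seminorm_A_scale.
  by rewrite ler_wpM2l ?scalar_abs_ge0 // opnorm_A_upper_bound.
move=> bf; apply/eqP; rewrite eq_le le //=.
have [->|a0] := eqVneq a 0.
  rewrite /scalar_abs normr0 raddf0 mul0r; apply: opnorm_A_ge0.
  exact: is_A_bounded_operator_scale.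
have absM x y : scalar_abs (x * y) = scalar_abs x * scalar_abs y.
  by rewrite {1}/scalar_abs normrM -!scalar_absE scalar_reZ scalar_reK.
have abs1 : scalar_abs (1 : K) = 1.
  by rewrite -(rmorph1 ofr) scalar_abs_real normr1.
have abs_a : scalar_abs a * scalar_abs a^-1 = 1 by rewrite -absM mulfV.
have := le a^-1 (a *: f) (is_A_bounded_operator_scale _ bf).
rewrite scalerA mulVf // scale1r => /(ler_wpM2l (scalar_abs_ge0 a)).
by rewrite mulrA abs_a mul1r.
Qed.

End SemiHilbertSpace.

(** * Differentiability and smoothness *)

Theorem theorem2p14 (R : realType) (k : scalar_kind) (H : hilbertSpace R k)
    (A T : {linear H -> H}) :
  positive_operator A -> ~ (A =1 \0) ->
  A_bounded A T -> opnorm_A A T != 0 ->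
  gateaux_differentiable A T <-> A_smooth A T.
Proof.
move=> A_pos _ bT T_neq0.
(* The supremum of the empty set is [0], so [opnorm_A A T != 0] provides one. *)
have unit_vectors : [set x : H | seminorm_A A x = 1] !=set0.
  apply/set0P; apply: contraNneq T_neq0 => E.
  by rewrite /opnorm_A E image_set0 sup0.
pose D := @is_A_bounded_operator R k H A.
have DT : D T by exists T.
have N_gt0 : 0 < opnorm_A A T.
  by rewrite lt_neqAle eq_sym T_neq0 (opnorm_A_ge0 _ DT).
have addD := @is_A_bounded_operator_add R k H A A_pos.
have scaleD := @is_A_bounded_operator_scale R k H A.
have N_add := @opnorm_A_add R k H A A_pos unit_vectors.
have N_scale := @opnorm_A_scale R k H A unit_vectors.
have diffP :=
  differentiable_iff_right_derivative_odd addD scaleD N_add N_scale DT.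
have [odd_add add_odd] :=
  right_derivative_odd_iff_orthogonal_add addD scaleD N_add N_scale DT N_gt0.
split=> [dT|[_ _ sT] S bS].
  split=> // S1 S2 b1 b2; apply: odd_add; [|by exists S1|by exists S2].
  by move=> _ [S bS ->]; apply/diffP; [exists S | exact: dT].
apply/diffP; first by exists S.
apply: add_odd; last by exists S.
move=> _ _ [S1 b1 ->] [S2 b2 ->]; exact: sT.
Qed.
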